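(* For every positive integer $n$: $\mathrm{Tr}(n)\not\to C_k$ for every integer $k\ge 5$; $\mathrm{Tr}(n)\not\to H^+$; and $\mathrm{Tr}(n)\not\to K_{2,3}$.
   Context: For graphs $G$ and $H$, write $G\to H$ if every 2-edge-coloring of $G$ (every map $E(G)\to\{0,1\}$) contains a monochromatic copy of $H$ (a subgraph isomorphic to $H$ all of whose edges have the same color), and $G\not\to H$ otherwise. $C_k$ denotes the cycle on $k$ vertices. The iterated triangulation $\mathrm{Tr}(n)$ is the plane graph defined recursively: $\mathrm{Tr}(0)\cong K_3$ is the plane triangle (a triangulation with two faces); for $i\ge 0$, $\mathrm{Tr}(i+1)$ is obtained from $\mathrm{Tr}(i)$ by placing a new vertex inside each inner face of $\mathrm{Tr}(i)$ and joining it by edges to the three vertices on the boundary of that face. $H^+$ is the bipartite graph obtained by adding one edge to the unique 6-vertex tree with 4 leaves and 2 vertices of degree three; concretely, $H^+$ consists of a 4-cycle $v_1v_2v_3v_4v_1$ together with two pendant edges $v_1v_5$ and $v_2v_6$ at adjacent vertices of the cycle. *)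

(* Defs.v *)
From mathcomp Require Import all_boot.

Set Implicit Arguments.
Unset Strict Implicit.
Unset Printing Implicit Defensive.

Record sgraph := SGraph {
  vertex :> finType;
  adj : rel vertex;
  adj_sym : symmetric adj;
  adj_irrefl : irreflexive adj }.

Definition edges (G : sgraph) : {set {set G}} :=
  [set [set x; y] | x in [set: G], y in [set: G] & adj x y].

Definition edge (G : sgraph) := {e : {set G} | e \in edges G}.

Definition edge_coloring (G : sgraph) := edge G -> bool.

(* (W, F) is a subgraph of G with vertex set W and edge set F. *)
Definition is_subgraph (G : sgraph) (W : {set G}) (F : {set {set G}}) : Prop :=
  F \subset edges G /\ (forall e, e \in F -> e \subset W).

(* f is an isomorphism from H onto the subgraph (W, F) of G. *)
Definition sub_iso (H G : sgraph) (W : {set G}) (F : {set {set G}})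
    (f : H -> G) : Prop :=
  [/\ injective f, f @: [set: H] = W
    & forall x y : H, adj x y = ([set f x; f y] \in F)].

Definition monochromatic (G : sgraph) (c : edge_coloring G)
    (F : {set {set G}}) : Prop :=
  exists b : bool, forall e : edge G, val e \in F -> c e = b.

Definition arrows (G H : sgraph) : Prop :=
  forall c : edge_coloring G,
  exists (W : {set G}) (F : {set {set G}}),
    [/\ is_subgraph W F, exists f : H -> G, sub_iso W F f
      & monochromatic c F].

(* A genuine cycle only for k >= 3; the test i != j matters only for k = 1. *)
Definition cycle_rel (k : nat) : rel 'I_k :=
  fun i j => (i != j) && ((j == i.+1 %% k :> nat) || (i == j.+1 %% k :> nat)).

Lemma cycle_sym k : symmetric (@cycle_rel k).
Proof. by move=> i j; rewrite /cycle_rel eq_sym orbC. Qed.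

Lemma cycle_irrefl k : irreflexive (@cycle_rel k).
Proof. by move=> i; rewrite /cycle_rel eqxx. Qed.

Definition cycle_graph (k : nat) : sgraph :=
  SGraph (@cycle_sym k) (@cycle_irrefl k).

Definition bip_rel (s t : nat) : rel ('I_s + 'I_t) :=
  fun x y => match x, y with
             | inl _, inr _ | inr _, inl _ => true
             | _, _ => false
             end.

Lemma bip_sym s t : symmetric (@bip_rel s t).
Proof. by case=> x [] y. Qed.

Lemma bip_irrefl s t : irreflexive (@bip_rel s t).
Proof. by case. Qed.

Definition complete_bipartite (s t : nat) : sgraph :=
  SGraph (@bip_sym s t) (@bip_irrefl s t).

(* The vertex v_(i+1) of H^+ is i : 'I_6. *)
Definition Hplus_edges : seq (nat * nat) :=
  [:: (0, 1); (1, 2); (2, 3); (3, 0); (0, 4); (1, 5)].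

Definition Hplus_rel : rel 'I_6 :=
  fun i j => ((i : nat, j : nat) \in Hplus_edges)
          || ((j : nat, i : nat) \in Hplus_edges).

Lemma Hplus_sym : symmetric Hplus_rel.
Proof. by move=> i j; rewrite /Hplus_rel orbC. Qed.

Lemma Hplus_irrefl : irreflexive Hplus_rel.
Proof. by case=> [[|[|[|[|[|[|]]]]]]]. Qed.

Definition Hplus : sgraph := SGraph Hplus_sym Hplus_irrefl.

(* The part of the plane structure that the recursion uses: a graph whose
   inner faces are triangles, with the three boundary vertices of each one.
   The outer face is not recorded, as it is never subdivided. *)
Record triangulation := Triangulation {
  tgraph :> sgraph;
  inner_face : finType;
  corner : inner_face -> 'I_3 -> tgraph }.

Lemma triangle_sym : symmetric (fun i j : 'I_3 => i != j).
Proof. by move=> i j; rewrite eq_sym. Qed.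

Lemma triangle_irrefl : irreflexive (fun i j : 'I_3 => i != j).
Proof. by move=> i; rewrite eqxx. Qed.

Definition triangle : triangulation :=
  @Triangulation (SGraph triangle_sym triangle_irrefl) unit (fun _ i => i).

Section Subdivide.

Variable T : triangulation.

(* The vertex inr f is the one placed inside the inner face f. *)
Definition subdivide_rel : rel (T + inner_face T) :=
  fun u v => match u, v with
             | inl x, inl y => adj x y
             | inl x, inr f | inr f, inl x => [exists i, corner f i == x]
             | inr _, inr _ => false
             end.

Lemma subdivide_sym : symmetric subdivide_rel.
Proof. by case=> x [] y //=; rewrite adj_sym. Qed.

Lemma subdivide_irrefl : irreflexive subdivide_rel.
Proof. by case=> x //=; rewrite adj_irrefl. Qed.

(* The inner face f is split into the three faces (f, i); the corners of
   (f, i) are those of f with the i-th one replaced by the new vertex. *)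
Definition subdivide : triangulation :=
  @Triangulation (SGraph subdivide_sym subdivide_irrefl)
    (inner_face T * 'I_3)%type
    (fun fi j => if j == fi.2 then inr fi.1 else inl (corner fi.1 j)).

End Subdivide.

Definition Tr (n : nat) : triangulation := iter n subdivide triangle.

(* Main.v *)
Require Import Defs.
From mathcomp Require Import all_boot zify.

(** Long cycles and H^+.  Label the vertices by booleans so that every inner
    face carries both labels: a new vertex takes the minority label of its face.
    Colour an edge by the negation of the common label of its ends, or, if they
    differ, by the label of the end created last.  In colour [b] the vertices
    labelled [~~ b] span a forest, while each vertex labelled [b] has degree two
    and is joined to the two ends of an edge of that forest.  Hence the blocks
    are books, whose cycles have length at most four, and every edge of a
    4-cycle has an end of degree two.

    K_{2,3}.  Let every inner face pick one of its edges and a colour, and join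
    the vertex placed in it to the ends of that edge in the picked colour and to
    the third corner in the other one.  If the three faces around a new vertex
    pick its three edges, each once, then every edge is picked at most once in
    the whole process, and the colours can be chosen so that no two vertices
    ever get three common neighbours in one colour. *)

Set Implicit Arguments.
Unset Strict Implicit.
Unset Printing Implicit Defensive.

(** An edge determines its ends up to order, so a function symmetric on adjacent pairs induces an
    edge colouring with the same colours. *)
Lemma not_arrows (G H : sgraph) (col : G -> G -> bool) :
  (forall x y, adj x y -> col x y = col y x) ->
  (forall b (f : H -> G), injective f ->
     (forall x y, adj x y -> adj (f x) (f y) /\ col (f x) (f y) = b) -> False) ->
  ~ arrows G H.
Proof.
move=> colC nocopy arr.
pose P (e : {set G}) x y := [&& e == [set x; y], adj x y & col x y].
pose c (e : edge G) := [exists x, exists y, P (val e) x y].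
case: (arr c) => W [F [[Fsub _] [f [f_inj _ f_iso]] [b cb]]].
apply: (nocopy b f f_inj) => x y; rewrite f_iso => xyF.
have xyE := subsetP Fsub _ xyF.
have pairE (u v u' v' : G) : [set u; v] = [set u'; v'] -> adj u v ->
    (u' = u /\ v' = v) \/ (u' = v /\ v' = u).
  move=> E uv; have := set21 u' v'; rewrite -E => /set2P [eu|eu].
    have := set22 u v; rewrite E => /set2P [ev|ev]; last by left.
    by move: uv; rewrite ev eu adj_irrefl.
  have := set21 u v; rewrite E => /set2P [ev|ev]; last by right.
  by move: uv; rewrite ev eu adj_irrefl.
have xy : adj (f x) (f y).
  case/imset2P: (xyE) => u v _; rewrite inE => /andP [_ uv] /esym E.
  by case: (pairE _ _ _ _ E uv) => -[-> ->] //; rewrite adj_sym.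
split=> //; rewrite -(cb (exist (fun e => e \in edges G) _ xyE) xyF).
apply/idP/idP => [cxy|].
  by apply/existsP; exists (f x); apply/existsP; exists (f y); rewrite /P eqxx xy.
case/existsP => u /existsP [v /and3P [/= /eqP E uv cuv]].
by case: (pairE _ _ _ _ E xy) cuv => -[-> ->] //; rewrite colC // adj_sym.
Qed.

(** * Colourings without long cycles and without H^+ *)

(* The older neighbours of a vertex with its own label form at most a singleton;
   those with the opposite label form a clique of size at most two. *)
Definition good_labelling (G : sgraph) (lab : G -> bool) (age : G -> nat) : Prop :=
  [/\ forall u v, adj u v -> age u != age v,
      forall u v w, adj w u -> adj w v -> lab u = lab w -> lab v = lab w ->
        age u < age w -> age v < age w -> u = v,
      forall u v w, adj w u -> adj w v -> lab u != lab w -> lab v != lab w ->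
        age u < age w -> age v < age w -> u != v -> adj u v
    & forall u v x w, adj w u -> adj w v -> adj w x ->
        lab u != lab w -> lab v != lab w -> lab x != lab w ->
        age u < age w -> age v < age w -> age x < age w ->
        [|| u == v, u == x | v == x]].

Section GoodLabelling.

Variables (G : sgraph) (lab : G -> bool) (age : G -> nat).
Hypothesis good : good_labelling lab age.

Definition label_color (u v : G) : bool :=
  if lab u == lab v then ~~ lab u else if age u < age v then lab v else lab u.

Lemma label_colorC u v : adj u v -> label_color u v = label_color v u.
Proof.
case: good => age_neq _ _ _ /age_neq; rewrite /label_color [lab v == _]eq_sym.
by case: (lab u =P lab v) => [->|_] //; case: ltngtP.
Qed.

Variable b : bool.

Definition mono (u v : G) : Prop := adj u v /\ label_color u v = b.

Lemma mono_sym u v : mono u v -> mono v u.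
Proof. by case=> uv c; split; [rewrite adj_sym | rewrite -label_colorC]. Qed.

(** Equal labels [b] would give colour [~~ b]; with distinct labels the colour [b] is the label of
    the younger end, which must be [z]. *)
Lemma mono_page z u : mono z u -> lab z = b -> lab u = ~~ b /\ age u < age z.
Proof.
case=> zu; case: good => /(_ _ _ zu) + _ _ _.
rewrite /label_color; move=> + + lz; rewrite lz.
by case: (lab u) (b) => [] [] //=; case: ltngtP.
Qed.

Lemma page_nbrs_adj z u v :
  lab z = b -> mono z u -> mono z v -> u != v -> adj u v /\ lab v = ~~ b.
Proof.
move=> lz zu zv uv.
have [lu au] := mono_page zu lz; have [lv av] := mono_page zv lz.
split=> //; case: good => _ _ page _; case: zu zv => zu _ [zv _].
by apply: (page _ _ z) => //; rewrite ?lu ?lv lz; case: b.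
Qed.

Lemma mono_degree3 z u v x : mono z u -> mono z v -> mono z x ->
  u != v -> u != x -> v != x -> lab z = ~~ b.
Proof.
move=> zu zv zx uv ux vx; case: (eqVneq (lab z) b) => [lz|]; last first.
  by case: (lab z) b => [] [].
have [lu au] := mono_page zu lz; have [lv av] := mono_page zv lz.
have [lx ax] := mono_page zx lz.
case: good => _ _ _ /(_ u v x z); case: zu zv zx => zu _ [zv _] [zx _].
rewrite lu lv lx lz (negPf uv) (negPf ux) (negPf vx).
by move/(_ zu zv zx); case: b => /= /(_ isT isT isT au av ax).
Qed.

(* The vertices labelled [~~ b] span a forest: no vertex has two older
   neighbours in it. *)
Lemma forest_older u v w : adj w u -> adj w v ->
  lab u = ~~ b -> lab v = ~~ b -> lab w = ~~ b -> u != v ->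
  ~~ ((age u < age w) && (age v < age w)).
Proof.
move=> wu wv lu lv lw; apply: contraNN => /andP [au av]; apply/eqP.
by case: good => _ uniq _ _; apply: (uniq _ _ w); rewrite ?lu ?lv.
Qed.

(** The youngest vertex would contradict [forest_older]; the same holds for a 4-cycle below. *)
Lemma forest_triangle u v w : adj u v -> adj v w -> adj w u ->
  lab u = ~~ b -> lab v = ~~ b -> lab w = ~~ b -> False.
Proof.
move=> uv vw wu lu lv lw.
have neq (x y : G) : adj x y -> x != y.
  by apply: contraTneq => ->; rewrite adj_irrefl.
have [vu wv uw] : [/\ adj v u, adj w v & adj u w] by split; rewrite adj_sym.
case: (good) => nage _ _ _; move: (nage _ _ uv) (nage _ _ vw) (nage _ _ wu).
have := forest_older uv uw lv lw lu (neq _ _ vw).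
have := forest_older vw vu lw lu lv (neq _ _ wu).
have := forest_older wu wv lu lv lw (neq _ _ uv).
move: (age u) (age v) (age w) => a1 a2 a3; clear; lia.
Qed.

Lemma forest_C4 u v w x : adj u v -> adj v w -> adj w x -> adj x u ->
  u != w -> v != x ->
  lab u = ~~ b -> lab v = ~~ b -> lab w = ~~ b -> lab x = ~~ b -> False.
Proof.
move=> uv vw wx xu nuw nvx lu lv lw lx.
have [vu wv xw ux] : [/\ adj v u, adj w v, adj x w & adj u x].
  by split; rewrite adj_sym.
case: (good) => nage _ _ _.
move: (nage _ _ uv) (nage _ _ vw) (nage _ _ wx) (nage _ _ xu).
have := forest_older uv ux lv lx lu nvx.
have := forest_older vu vw lu lw lv nuw.
have := forest_older wv wx lv lx lw nvx.
have := forest_older xu xw lu lw lx nuw.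
move: (age u) (age v) (age w) (age x) => a1 a2 a3 a4; clear; lia.
Qed.

(** The two vertices of degree three are labelled [~~ b]. If another cycle vertex is labelled [b],
    its two cycle neighbours are adjacent and close a triangle in the forest; otherwise the forest
    contains the 4-cycle. *)
Lemma no_mono_Hplus (f : Hplus -> G) : injective f ->
  (forall x y, adj x y -> mono (f x) (f y)) -> False.
Proof.
move=> f_inj f_mono.
pose v i : G := f (inord i).
have vE i j : i < 6 -> j < 6 -> i != j -> v i != v j.
  by move=> i6 j6; rewrite (inj_eq f_inj) -val_eqE /= !inordK.
have vM i j : i < 6 -> j < 6 -> (i, j) \in Hplus_edges -> mono (v i) (v j).
  by move=> i6 j6 ij; apply: f_mono; rewrite /= /Hplus_rel !inordK // ij.
have m01 : mono (v 0) (v 1) by exact: vM.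
have m12 : mono (v 1) (v 2) by exact: vM.
have m23 : mono (v 2) (v 3) by exact: vM.
have m30 : mono (v 3) (v 0) by exact: vM.
have l0 : lab (v 0) = ~~ b.
  by apply: (mono_degree3 (u := v 1) (v := v 3) (x := v 4));
     rewrite ?vE //; [exact: mono_sym | exact: vM].
have l1 : lab (v 1) = ~~ b.
  by apply: (mono_degree3 (u := v 0) (v := v 2) (x := v 5));
     rewrite ?vE //; [exact: mono_sym | exact: vM].
have [a01 _] := m01; have [a12 _] := m12; have [a23 _] := m23.
have [a30 _] := m30.
case: (eqVneq (lab (v 2)) b) => [l2|/eqP l2].
  have [a13 l3] := page_nbrs_adj l2 (mono_sym m12) m23 (vE 1 3 isT isT isT).
  exact: (forest_triangle a01 a13 a30).
case: (eqVneq (lab (v 3)) b) => [l3|/eqP l3].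
  have [a20 _] := page_nbrs_adj l3 (mono_sym m23) m30 (vE 2 0 isT isT isT).
  by apply: (forest_triangle a01 a12 a20) => //; case: (lab _) b l2 => [] [].
apply: (forest_C4 a01 a12 a23 a30) => //; rewrite ?vE //.
  by case: (lab _) b l2 => [] [].
by case: (lab _) b l3 => [] [].
Qed.

(* The last vertex of the cycle labelled [~~ b] has, on either side, a vertex
   labelled [~~ b] at distance one or two along the cycle, adjacent to it and
   older; the two coincide, so the cycle has length at most four. *)
Lemma no_mono_cycle k (f : cycle_graph k -> G) : 5 <= k -> injective f ->
  (forall x y, adj x y -> mono (f x) (f y)) -> False.
Proof.
move=> k5 f_inj f_mono; have k0 : 0 < k by exact: leq_trans k5.
pose o i : 'I_k := Ordinal (ltn_pmod i k0).
pose g i : G := f (o i).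
have g_eq i j : g i = g j -> i = j %[mod k] by move/f_inj/(congr1 val).
have g_neq i d : 0 < d < k -> g i != g (i + d).
  move=> /andP [d0 dk]; apply/eqP => /g_eq /eqP.
  by rewrite eq_sym -{2}[i]addn0 eqn_modDl mod0n modn_small //; lia.
have gM i : mono (g i) (g i.+1).
  apply: f_mono; rewrite /= /cycle_rel /= -(addn1 (i %% k)) modnDml addn1 eqxx /=.
  rewrite andbT -val_eqE /=; apply/eqP => E.
  have := g_neq i 1; rewrite addn1 => /(_ ltac:(lia)) /eqP; apply.
  by congr f; apply: val_inj.
have gMr i : mono (g i.+1) (g i) by exact: mono_sym.
have labNb z : lab z != b -> lab z = ~~ b by case: (lab z) b => [] [].
have ex_i : exists i : 'I_k, lab (g i) == ~~ b.
  have i0 : g (val (o 0)) = g 0 by congr f; apply: val_inj; rewrite /= !mod0n.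
  have i1 : g (val (o 1)) = g 1 by congr f; apply: val_inj; rewrite /= modn_mod.
  case: (eqVneq (lab (g 0)) b) => [/(mono_page (gM 0)) [l1 _]|/labNb l0].
    by exists (o 1); rewrite i1 l1.
  by exists (o 0); rewrite i0 l0.
case: ex_i => i0 li0.
case: (arg_maxnP (P := fun i : 'I_k => lab (g i) == ~~ b) (fun i => age (g i)) li0).
move=> i /eqP li imax.
have gmax j : lab (g j) = ~~ b -> age (g j) <= age (g i).
  have -> : g j = g (o j) by congr f; apply: val_inj; rewrite /= modn_mod.
  by move=> lj; apply: imax; rewrite lj.
(* Shifting by a full turn keeps the subtractions [m - e] from being truncated. *)
pose m := i + k.
have gi : g i = g m by congr f; apply: val_inj; rewrite /= modnDr.
rewrite gi in li gmax.
have [age_neq _ _ _] := good.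
have older j : adj (g m) (g j) -> lab (g j) = ~~ b -> age (g j) < age (g m).
  by move=> /age_neq mj /gmax; rewrite leq_eqVlt eq_sym (negPf mj).
have [d dle [ad ld]] : exists2 d, 0 < d <= 2 &
    adj (g m) (g (m + d)) /\ lab (g (m + d)) = ~~ b.
  case: (eqVneq (lab (g m.+1)) b) => [l1|/labNb l1].
    have ne : g m != g m.+2 by rewrite -addn2 g_neq //; lia.
    by exists 2; rewrite // addn2; apply: (page_nbrs_adj l1).
  by exists 1; rewrite // addn1; case: (gM m).
have [e ele [ae le]] : exists2 e, 0 < e <= 2 &
    adj (g m) (g (m - e)) /\ lab (g (m - e)) = ~~ b.
  have E1 : (m - 1).+1 = m by lia.
  have E2 : (m - 2).+1 = m - 1 by lia.
  have m1 := gMr (m - 1); rewrite E1 in m1.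
  have m2 := gMr (m - 2); rewrite E2 in m2.
  case: (eqVneq (lab (g (m - 1))) b) => [l1|/labNb l1].
    have ne : g m != g (m - 2).
      have := g_neq (m - 2) 2; rewrite eq_sym subnK; last by lia.
      by apply; lia.
    by exists 2 => //; apply: (page_nbrs_adj l1) => //; exact: mono_sym.
  by exists 1 => //; case: m1.
(* The two indices differ by [d + e], at most 4 and so less than [k]. *)
have ne : g (m + d) != g (m - e).
  rewrite eq_sym; have -> : m + d = m - e + (d + e) by lia.
  by rewrite g_neq //; lia.
have := forest_older ad ae ld le li ne.
by rewrite !older.
Qed.

End GoodLabelling.


(** * Good labellings of the iterated triangulations *)

Notation i0 := (@Ordinal 3 0 isT).
Notation i1 := (@Ordinal 3 1 isT).
Notation i2 := (@Ordinal 3 2 isT).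

Lemma ord3P (i : 'I_3) : [\/ i = i0, i = i1 | i = i2].
Proof.
by case: i => [[|[|[|]]]] // lti;
   [apply: Or31 | apply: Or32 | apply: Or33]; apply: val_inj.
Qed.

Lemma sum_ord3 (F : 'I_3 -> nat) : \sum_i F i = F i0 + F i1 + F i2.
Proof.
rewrite !big_ord_recl big_ord0 addn0 addnA.
by congr (F _ + F _ + F _); apply: val_inj.
Qed.

Definition nonconstant (L : 'I_3 -> bool) := (L i0 != L i1) || (L i1 != L i2).

(** On a nonconstant triple the exclusive or is the label that occurs once. *)
Definition minority (L : 'I_3 -> bool) := L i0 (+) L i1 (+) L i2.

Lemma minority_uniq L i j : nonconstant L ->
  L i = minority L -> L j = minority L -> i = j.
Proof.
rewrite /nonconstant /minority.
case: (ord3P i) => ->; case: (ord3P j) => -> //;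
  by case: (L i0) (L i1) (L i2) => [] [] [].
Qed.

Lemma majority_two L i j k :
  L i != minority L -> L j != minority L -> L k != minority L ->
  [|| i == j, i == k | j == k].
Proof.
rewrite /minority.
case: (ord3P i) => ->; case: (ord3P j) => ->; case: (ord3P k) => -> //;
  by case: (L i0) (L i1) (L i2) => [] [] [].
Qed.

(** The two corners kept either differ already or both carry the majority label. *)
Lemma nonconstant_minority L L' i : nonconstant L -> L' i = minority L ->
  (forall j, j != i -> L' j = L j) -> nonconstant L'.
Proof.
rewrite /nonconstant /minority.
move=> nc; case: (ord3P i) => -> Li Lj; rewrite Li.
- by rewrite (Lj i1) // (Lj i2) //; case: (L i0) (L i1) (L i2) nc => [] [] [].
- by rewrite (Lj i0) // (Lj i2) //; case: (L i0) (L i1) (L i2) nc => [] [] [].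
- by rewrite (Lj i0) // (Lj i1) //; case: (L i0) (L i1) (L i2) nc => [] [] [].
Qed.

Definition faces_labelled (T : triangulation) (lab : T -> bool) : Prop :=
  forall f : inner_face T,
    (forall i j, i != j -> adj (corner f i) (corner f j)) /\
    nonconstant (fun i => lab (corner f i)).

Section SubdivideLabelling.

Variables (T : triangulation) (lab : T -> bool) (age : T -> nat).
Hypothesis good : good_labelling lab age.
Hypothesis faces : faces_labelled lab.

Definition sub_lab (u : subdivide T) : bool :=
  match u with
  | inl x => lab x
  | inr f => minority (fun i => lab (corner f i))
  end.

(** All new vertices may share one age, being pairwise nonadjacent. *)
Definition sub_age (u : subdivide T) : nat :=
  match u with inl x => age x | inr _ => (\max_x age x).+1 end.

Lemma age_old x : (age x < (\max_y age y).+1) = true.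
Proof. by rewrite ltnS (leq_bigmax x). Qed.

Lemma sub_older_inl (x : T) (u : subdivide T) :
  @adj (subdivide T) (inl x) u -> sub_age u < sub_age (inl x) ->
  exists y, u = inl y.
Proof. by case: u => [y|f] _ /=; [exists y | have := age_old x; lia]. Qed.

Lemma sub_adj_inr f (u : subdivide T) :
  @adj (subdivide T) (inr f) u -> exists i, u = inl (corner f i).
Proof. by case: u => [x|//] /existsP [i /eqP <-]; exists i. Qed.

Lemma sub_good : good_labelling sub_lab sub_age.
Proof.
case: (good) => age_neq uniq page two; split.
- case=> [x|f] [y|g] //=; first exact: age_neq.
    by move=> _; have := age_old x; lia.
  by move=> _; have := age_old y; lia.
- move=> u v [x|f] wu wv lu lv au av.
    have [u' eu] := sub_older_inl wu au; have [v' ev] := sub_older_inl wv av.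
    by subst; congr inl; apply: (uniq _ _ x).
  have [i eu] := sub_adj_inr wu; have [j ev] := sub_adj_inr wv.
  subst; congr (inl (corner f _)); have [_ nc] := faces f.
  exact: minority_uniq nc lu lv.
- move=> u v [x|f] wu wv lu lv au av uv.
    have [u' eu] := sub_older_inl wu au; have [v' ev] := sub_older_inl wv av.
    by subst; apply: (page _ _ x).
  have [i eu] := sub_adj_inr wu; have [j ev] := sub_adj_inr wv.
  subst; have [fadj _] := faces f; apply: fadj.
  by apply: contraNneq uv => ->.
- move=> u v y [x|f] wu wv wy lu lv ly au av ay.
    have [u' eu] := sub_older_inl wu au; have [v' ev] := sub_older_inl wv av.
    have [y' ey] := sub_older_inl wy ay.
    by subst; apply: (two u' v' y' x).
  have [i eu] := sub_adj_inr wu; have [j ev] := sub_adj_inr wv.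
  have [k ey] := sub_adj_inr wy; subst.
  case/or3P: (majority_two (L := fun i => lab (corner f i)) lu lv ly) => /eqP->;
    by rewrite eqxx ?orbT.
Qed.

Lemma sub_faces : faces_labelled sub_lab.
Proof.
case=> f i; have [fadj nc] := faces f; split=> [j k jk /=|].
  case: (eqVneq j i) => [ji|_]; case: (eqVneq k i) => [ki|_].
  - by rewrite ji ki eqxx in jk.
  - by apply/existsP; exists k.
  - by apply/existsP; exists j.
  - exact: fadj.
apply: (nonconstant_minority (i := i) nc) => /= [|j ji]; first by rewrite eqxx.
by rewrite (negPf ji).
Qed.

End SubdivideLabelling.

Lemma Tr_labelling n : exists (lab : Tr n -> bool) (age : Tr n -> nat),
  good_labelling lab age /\ faces_labelled lab.
Proof.
elim: n => [|n [lab [age [good faces]]]]; last first.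
  exists (sub_lab lab), (sub_age age).
  by split; [exact: sub_good | exact: sub_faces].
(* The initial triangle is created in index order, its last vertex alone being labelled [true]. *)
exists (fun i : 'I_3 => i == i2), (fun i : 'I_3 => val i).
split; last by move=> [].
split=> /=.
- by move=> i j; rewrite val_eqE.
- move=> i j k; case: (ord3P k) => ->; case: (ord3P i) => -> //;
    by case: (ord3P j) => ->.
- move=> i j k; case: (ord3P k) => ->; case: (ord3P i) => -> //;
    by case: (ord3P j) => ->.
- move=> i j l k; case: (ord3P k) => ->; case: (ord3P i) => -> //;
    by case: (ord3P j) => -> //; case: (ord3P l) => ->.
Qed.

(** * Colourings without K_{2,3} *)

Section Load.

Variables (T : triangulation) (col : T -> T -> bool).
Variables (apex : inner_face T -> 'I_3) (hue : inner_face T -> bool).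

Definition common (b : bool) (x y z : T) : bool :=
  [&& adj x z, adj y z, col x z == b & col y z == b].

(* The vertex to be placed inside [f] is joined in colour [hue f] to all
   corners but the one at [apex f]. *)
Definition picks (b : bool) (x y : T) (f : inner_face T) : bool :=
  [exists j, exists k, [&& j != k, j != apex f, k != apex f,
     corner f j == x, corner f k == y & hue f == b]].

(** Besides the present common neighbours in colour [b], this counts those that the next subdivision
    will create. *)
Definition load (b : bool) (x y : T) : nat :=
  \sum_z common b x y z + \sum_f picks b x y f.

Lemma picksP b x y f :
  reflect (exists j k, [/\ j != k, j != apex f, k != apex f,
             corner f j = x /\ corner f k = y & hue f = b])
          (picks b x y f).
Proof.
apply: (iffP existsP) => [[j /existsP [k]]|[j [k [jk ja ka [<- <-] <-]]]].
  case/and5P=> jk ja ka /eqP jx /andP [/eqP ky /eqP hb].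
  by exists j, k.
by exists j; apply/existsP; exists k; rewrite jk ja ka !eqxx.
Qed.

Lemma loadC b x y : load b x y = load b y x.
Proof.
congr (_ + _); apply: eq_bigr => z _; congr nat_of_bool.
  by rewrite /common andbCA; congr [&& _, _ & _]; rewrite andbC.
by apply/picksP/picksP => -[j [k [jk ja ka [jx ky] hb]]];
   exists k, j; rewrite eq_sym.
Qed.

Definition light : Prop :=
  [/\ forall x y, col x y = col y x,
      forall f : inner_face T, injective (corner f)
    & forall b x y, x != y -> load b x y <= 2].

Lemma no_mono_K23 b (f : complete_bipartite 2 3 -> T) : light -> injective f ->
  (forall x y, adj x y -> adj (f x) (f y) /\ col (f x) (f y) = b) -> False.
Proof.
case=> _ _ lgt f_inj f_mono.
have neq : f (inl ord0) != f (inl ord_max) by rewrite (inj_eq f_inj).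
have := leq_trans (leq_addr _ _) (lgt b _ _ neq); apply/negP; rewrite -ltnNge.
have inj_r : injective (fun i : 'I_3 => f (inr i)) by move=> i j /f_inj [].
rewrite -[\sum_z _]big_mkcond sum1_card.
have card3 := card_codom inj_r; rewrite card_ord in card3.
apply: leq_trans (eq_leq (esym card3)) _; apply: subset_leq_card.
apply/subsetP => z /codomP [i ->].
rewrite unfold_in /common.
by have [-> ->] := f_mono (inl ord0) (inr i) isT;
   have [-> ->] := f_mono (inl ord_max) (inr i) isT; rewrite eqxx.
Qed.

End Load.

(** * Subdivision keeps every load at most two *)

Section SubdivideLoad.

Variables (T : triangulation) (col : T -> T -> bool).
Variables (apex : inner_face T -> 'I_3) (hue : inner_face T -> bool).
Hypothesis lgt : light col apex hue.

Let S := subdivide T.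

Definition new_col (f : inner_face T) (x : T) : bool :=
  hue f (+) (x == corner f (apex f)).

Definition sub_col (u v : S) : bool :=
  match u, v with
  | inl x, inl y => col x y
  | inl x, inr f | inr f, inl x => new_col f x
  | inr _, inr _ => true
  end.

(* The three faces at a new vertex pick its three edges, each exactly once. *)
Definition sub_apex (g : inner_face S) : 'I_3 := ord_pred g.2.

(** The face [(f, i)] picks the edge from the new vertex to corner [ordS i]. Corner [i] is a
    possible common neighbour of its ends, and the hue avoids the colour of the new edge to it. *)
Definition sub_hue (g : inner_face S) : bool := ~~ new_col g.1 (corner g.1 g.2).

Lemma new_col_corner f i : new_col f (corner f i) = hue f (+) (i == apex f).
Proof. by case: lgt => _ inj _; rewrite /new_col (inj_eq (inj f)). Qed.

Lemma sum_corners f (Q : T -> bool) :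
  \sum_x ([exists i, corner f i == x] && Q x) <= \sum_i Q (corner f i).
Proof.
apply: (@leq_trans (\sum_x \sum_i ((corner f i == x) && Q x))).
  apply: leq_sum => x _; case: existsP => // -[i ix] /=.
  by rewrite (bigD1 i) //= ix leq_addr.
rewrite exchange_big /=; apply: leq_sum => i _.
rewrite (bigD1 (corner f i)) //= eqxx big1 ?addn0 // => x xi.
by rewrite eq_sym (negPf xi).
Qed.

Lemma new_degree b f : \sum_i (new_col f (corner f i) == b) <= 2.
Proof.
rewrite sum_ord3 !new_col_corner.
by case: (ord3P (apex f)) => ->; case: (hue f) b => [] [].
Qed.

Lemma picks_new b (u v : S) g : picks sub_apex sub_hue b u v g ->
  [/\ sub_hue g = b & (u = inr g.1 /\ v = inl (corner g.1 (ordS g.2)))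
                   \/ (v = inr g.1 /\ u = inl (corner g.1 (ordS g.2)))].
Proof.
case: g => f i /picksP [j [k [jk ja ka [<- <-] <-]]]; split=> //=.
have : j = i /\ k = ordS i \/ k = i /\ j = ordS i.
  have := jk; have := ja; have := ka; rewrite /sub_apex /=.
  case: (ord3P i) => ->; case: (ord3P j) => ->; case: (ord3P k) => -> //= _ _ _;
  first [by left; split=> //; apply: val_inj
        | by right; split=> //; apply: val_inj].
have ni : (ordS i == i) = false by case: (ord3P i) => ->.
by case=> -[-> ->]; rewrite eqxx ni; [left | right].
Qed.

(** A new common neighbour was already counted as a pick of its face, and the new faces pick no pair
    of old vertices. *)
Lemma load_old b x y : x != y ->
  load sub_col sub_apex sub_hue b (inl x) (inl y) <= 2.
Proof.
move=> xy; case: lgt => _ _ /(_ b _ _ xy); apply: leq_trans.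
rewrite /load big_sumType /= -addnA leq_add2l.
rewrite [X in _ + X]big1 ?addn0; last first.
  move=> g _; case: (boolP (picks _ _ _ _ _ _)) => // /picks_new [_].
  by case=> -[].
apply: leq_sum => f _; case: (boolP (common _ _ _ _ _)) => //.
case/and4P=> /existsP [j /eqP jx] /existsP [k /eqP ky] /eqP /= cx /eqP cy.
suff -> : picks apex hue b x y f by [].
move: xy cx cy; rewrite -jx -ky !new_col_corner => xy.
have jk : j != k by apply: contraNneq xy => ->.
case: (eqVneq j (apex f)) => [ja|ja]; case: (eqVneq k (apex f)) => [ka|ka].
- by rewrite ja ka eqxx in jk.
- by move=> <-; case: (hue f).
- by move=> <-; case: (hue f).
- by rewrite !addbF => hb _; apply/picksP; exists j, k.
Qed.

Lemma load_new b f (v : S) : v != inr f ->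
  load sub_col sub_apex sub_hue b (inr f) v <= 2.
Proof.
move=> vf; rewrite /load big_sumType /=.
rewrite [X in _ + X + _]big1 ?addn0; last by [].
have le2 : \sum_x (common sub_col b (inr f) v (inl x) : nat) <= 2.
  apply: leq_trans (new_degree b f).
  apply: leq_trans (sum_corners f (fun x => new_col f x == b)).
  apply: leq_sum => x _; rewrite /common; case: and4P => // -[fx _ fb _].
  by move: fx fb => /= -> ->.
(* Unless [v] is a corner of [f], no new face picks the pair, and [le2] suffices. *)
have [/existsP [m /eqP vm]|nocorner] :=
  boolP [exists m, v == inl (corner f m)]; last first.
  rewrite [X in _ + X]big1 ?addn0 // => g _.
  case: (boolP (picks _ _ _ _ _ _)) => // /picks_new [_].
  case=> -[]; last by [].
  case=> fg vE; case/negP: nocorner; apply/existsP.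
  by exists (ordS g.2); rewrite vE -fg.
(* Only the face [(f, ord_pred m)] can pick the pair. *)
set P := (X in _ + X <= _); have leP : P <= (sub_hue (f, ord_pred m) == b).
  rewrite /P (bigD1 (f, ord_pred m : 'I_3)) //= big1 ?addn0 => [|[h i] ghi].
    by case: (boolP (picks _ _ _ _ _ _)) => // /picks_new [-> _]; rewrite eqxx.
  case: (boolP (picks _ _ _ _ _ _)) => // /picks_new [_].
  rewrite vm; case=> -[] //= -[hf] [cm]; case/negP: ghi.
  case: lgt => _ inj _; move: cm; rewrite -hf => /inj ->.
  by rewrite ordSK eqxx.
pose Q x := (x != corner f m) && (new_col f x == b).
have leN : \sum_x (common sub_col b (inr f) v (inl x) : nat)
    <= \sum_i Q (corner f i).
  apply: leq_trans (sum_corners f Q).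
  apply: leq_sum => x _; rewrite /common vm; case: and4P => // -[fx vx fb _].
  have xm : x != corner f m by apply: contraTneq vx => ->; rewrite /= adj_irrefl.
  by move: fx fb; rewrite /= /Q xm => -> ->.
apply: leq_trans (leq_add leN leP) _.
(* At most two corners and one pick remain, and the pick has the colour opposite to that of corner
   [ord_pred m], so not all three count. *)
rewrite sum_ord3 /Q /sub_hue /=.
case: (lgt) => _ inj _; rewrite !(inj_eq (inj f)).
have [p0 p1 p2] : [/\ ord_pred i0 = i2, ord_pred i1 = i0 & ord_pred i2 = i1].
  by split; apply: val_inj.
case: (ord3P m) => ->; rewrite ?p0 ?p1 ?p2 /=;
  by case: (new_col f (corner f i0)) (new_col f (corner f i1))
           (new_col f (corner f i2)) (b) => [] [] [] [].
Qed.

Lemma sub_light : light sub_col sub_apex sub_hue.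
Proof.
case: (lgt) => colC inj _; split.
- by case=> [x|f] [y|g] //=; apply: colC.
- case=> f i j k /=; case: eqP => [->|_]; case: eqP => [->|_] //.
  by move=> -[] /inj.
- move=> b [x|f] [y|g] xy; last by apply: load_new; rewrite eq_sym.
  + exact: load_old.
  + by rewrite loadC load_new.
  + exact: load_new.
Qed.

End SubdivideLoad.

Lemma Tr_light n : exists col apex hue, @light (Tr n) col apex hue.
Proof.
elim: n => [|n [col [apex [hue lgt]]]]; last first.
  exists (sub_col col apex hue), (@sub_apex _), (sub_hue apex hue).
  exact: sub_light.
exists (fun _ _ => true), (fun _ => i2), (fun _ => true); split=> //.
  by move=> f i j.
(* One for the third vertex of the triangle, one for its only inner face. *)
move=> b x y xy; apply: (@leq_trans (1 + 1)) => //.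
apply: leq_add; last first.
  by rewrite (bigD1 tt) //= big1 ?addn0 => [|[]] //; case: (picks _ _ _ _ _ _).
rewrite sum_ord3 /common /=; move: xy.
by case: (ord3P x) => ->; case: (ord3P y) => -> //; case: b.
Qed.

Theorem theorem1p1 (n : nat) (n_gt0 : 0 < n) :
  [/\ forall k : nat, 5 <= k -> ~ arrows (Tr n) (cycle_graph k),
      ~ arrows (Tr n) Hplus
    & ~ arrows (Tr n) (complete_bipartite 2 3)].
Proof.
have [lab [age [good _]]] := Tr_labelling n.
have [col [apex [hue lgt]]] := Tr_light n.
split=> [k k5||].
- apply: (not_arrows (label_colorC good)) => b f f_inj f_mono.
  exact: (no_mono_cycle good k5 f_inj f_mono).
- apply: (not_arrows (label_colorC good)) => b f f_inj f_mono.
  exact: (no_mono_Hplus good f_inj f_mono).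
- case: (lgt) => colC _ _.
  apply: (not_arrows (col := col)) => // b f f_inj f_mono.
  exact: (no_mono_K23 lgt f_inj f_mono).
Qed.
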